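(* Let $f_0,\dots,f_q$ be continuously differentiable $\mathbb{R}^n$-valued functions of $(x_v,\varepsilon_v)\in\mathbb{R}^n\times\mathbb{R}^s$, let $\theta=(\theta_0,\dots,\theta_q)$ be a real parameter vector, and consider the agent model $$x_v(t+1)=\sum_{i=0}^{q}\theta_i f_i(x_v(t),\varepsilon_v(t)),\qquad t=0,1,2,\dots$$ Put $F(x_v,\theta)=\sum_{i=0}^{q}\theta_i\frac{\partial}{\partial x_v}f_i(x_v,\varepsilon_v)\in\mathbb{R}^{n\times n}$. Suppose there exist a symmetric matrix $P_v\in\mathbb{R}^{n\times n}$ with $P_v>0$ and a real number $\kappa>0$ such that $$\begin{bmatrix}(2-\kappa)I_n-P_v & F(x_v,\theta)^{\mathrm T}\\ F(x_v,\theta) & P_v\end{bmatrix}\succeq 0$$ for all $x_v$ (and all $\varepsilon_v$). Then the model is globally incrementally $l_2$ contraction stable.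
   Context: Here $x_v(t)\in\mathbb{R}^n$ is the state of agent $v$ and $\varepsilon_v(t)\in\mathbb{R}^s$ is an exogenous noise signal. The functions $f_i$ may also depend on an exogenous input $u_v(t)\in\mathbb{R}^m$, which is suppressed from the notation (when present, the matrix inequality is required for all its values too). $P_v>0$ means positive definite, $\succeq 0$ means positive semidefinite, and $I_n$ is the identity matrix. Definition (global incremental $l_2$ contraction stability). The model $x_v(t+1)=f(x_v(t),u_v(t),\varepsilon_v(t),\theta)$, where here $f=\sum_{i=0}^q\theta_i f_i$, is incrementally $l_2$ contraction stable if, for any two distinct initial values $x_{v1}(0),x_{v2}(0)\in\mathbb{R}^n$ and every input sequence (the same exogenous signals $u_v,\varepsilon_v$ being applied to both trajectories), the corresponding states $x_{v1}(t)$ and $x_{v2}(t)$ satisfy $\sum_{t=0}^{\infty}|x_{v1}(t)-x_{v2}(t)|^2<\infty$. *)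

(* Defs.v *)
From HB Require Import structures.
From mathcomp Require Import all_boot all_order all_algebra.
From mathcomp Require Import all_classical all_reals all_analysis.

Set Implicit Arguments.
Unset Strict Implicit.
Unset Printing Implicit Defensive.

Import Order.TTheory GRing.Theory Num.Theory.
Import numFieldNormedType.Exports.

Local Open Scope ring_scope.

(** Vectors of R^n are row vectors ['rV[R]_n], as in the library's [jacobian].
    The canonical norm [`|v|] of ['rV[R]_n] is the max norm, whence [enorm]. *)
Definition enorm (R : realType) (n : nat) (v : 'rV[R]_n) : R :=
  Num.sqrt (\sum_(i < n) v 0 i ^+ 2).

Definition posdefmx (R : realType) (n : nat) (M : 'M[R]_n) : Prop :=
  M^T = M /\ forall v : 'rV[R]_n, v != 0 -> 0 < (v *m M *m v^T) 0 0.

Definition possemidefmx (R : realType) (n : nat) (M : 'M[R]_n) : Prop :=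
  M^T = M /\ forall v : 'rV[R]_n, 0 <= (v *m M *m v^T) 0 0.

Definition cont_diff (R : realType) (a b : nat) (g : 'rV[R]_a -> 'rV[R]_b) :
    Prop :=
  (forall z, differentiable g z) /\ continuous (jacobian g).

Definition agent_model (R : realType) (n m s q : nat)
    (f : 'I_q.+1 -> 'rV[R]_n -> 'rV[R]_m -> 'rV[R]_s -> 'rV[R]_n)
    (theta : 'rV[R]_q.+1) (x : 'rV[R]_n) (u : 'rV[R]_m) (e : 'rV[R]_s) :
    'rV[R]_n :=
  \sum_(i < q.+1) theta 0 i *: f i x u e.

(** [jacobian g x] acts on row vectors from the right: its (j, k) entry is the
    partial derivative of the k-th component of [g] in the j-th coordinate, so
    the usual matrix of partial derivatives is its transpose. *)
Definition state_jacobian (R : realType) (n m s q : nat)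
    (f : 'I_q.+1 -> 'rV[R]_n -> 'rV[R]_m -> 'rV[R]_s -> 'rV[R]_n)
    (theta : 'rV[R]_q.+1) (x : 'rV[R]_n) (u : 'rV[R]_m) (e : 'rV[R]_s) :
    'M[R]_n :=
  \sum_(i < q.+1) theta 0 i *: (jacobian (fun y => f i y u e) x)^T.

Definition trajectory (R : realType) (n m s : nat)
    (g : 'rV[R]_n -> 'rV[R]_m -> 'rV[R]_s -> 'rV[R]_n)
    (u : nat -> 'rV[R]_m) (e : nat -> 'rV[R]_s) (x : nat -> 'rV[R]_n) : Prop :=
  forall t : nat, x t.+1 = g (x t) (u t) (e t).

Definition incrementally_l2_contraction_stable (R : realType) (n m s : nat)
    (g : 'rV[R]_n -> 'rV[R]_m -> 'rV[R]_s -> 'rV[R]_n) : Prop :=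
  forall (u : nat -> 'rV[R]_m) (e : nat -> 'rV[R]_s) (x1 x2 : nat -> 'rV[R]_n),
    trajectory g u e x1 -> trajectory g u e x2 -> x1 0%N <> x2 0%N ->
    (\sum_(0 <= t <oo) (enorm (x1 t - x2 t) ^+ 2)%:E < +oo)%E.

(* Main.v *)
Require Import Defs.
From HB Require Import structures.
From mathcomp Require Import all_boot all_order all_algebra.
From mathcomp Require Import all_classical all_reals all_analysis.
From mathcomp Require Import lra.

Set Implicit Arguments.
Unset Strict Implicit.
Unset Printing Implicit Defensive.

Import Order.TTheory GRing.Theory Num.Theory.
Import numFieldNormedType.Exports.

Local Open Scope ring_scope.

(** The storage function is [V v = v P^-1 v^T]. Let [d], [d'] be consecutive
    differences of two trajectories. The mean value theorem is applied to the
    scalar function [<g(x2 + s d), P^-1 d'>], so that [V d' = d J P^-1 d'^T] for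
    the Jacobian [J] at a single intermediate state. Evaluating the matrix
    inequality there at the vector [(d, - P^-1 d')] gives
    [V d' <= (2 - kappa) |d|^2 - d P d^T], and Young's inequality bounds the
    right-hand side by [V d - kappa |d|^2]; summing over time telescopes. *)

Lemma differentiable_mulmxr (R : realType) (n p : nat) (M : 'M[R]_(n, p))
    (x : 'rV[R]_n) :
  differentiable (mulmxr M : 'rV[R]_n -> 'rV[R]_p) x.
Proof.
rewrite (_ : (mulmxr M : 'rV_n -> 'rV_p) =
    \sum_(i < n) (fun y : 'rV[R]_n => y 0 i *: row i M)).
  apply: differentiable_sum => i.
  exact/differentiableZl/differentiable_coord.
by apply/funext => y; rewrite fct_sumE /= mulmx_sum_row.
Qed.

Lemma is_diff_mulmxr (R : realType) (n p : nat) (M : 'M[R]_(n, p))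
    (x : 'rV[R]_n) :
  is_diff x (mulmxr M : 'rV[R]_n -> 'rV[R]_p) (mulmxr M).
Proof.
apply: DiffDef; first exact: differentiable_mulmxr.
apply: diff_lin => y; exact/differentiable_continuous/differentiable_mulmxr.
Qed.

(** Freezing [e] is precomposition with the affine embedding of [y] as the row [(y, e)], written as
    a matrix product plus a constant so that the chain rule applies. *)
Lemma differentiable_partial (R : realType) (n s p : nat)
    (h : 'rV[R]_n -> 'rV[R]_s -> 'rV[R]_p) (e : 'rV[R]_s) (y : 'rV[R]_n) :
  (forall z : 'rV[R]_(n + s),
     differentiable (fun z => h (lsubmx z) (rsubmx z)) z) ->
  differentiable (fun y => h y e) y.
Proof.
move=> dh.
rewrite (_ : (fun y => h y e) =
    (fun z : 'rV_(n + s) => h (lsubmx z) (rsubmx z)) \o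
    (mulmxr (row_mx 1%:M 0) + cst (row_mx 0 e))); last first.
  apply/funext => z.
  have rowE : z *m row_mx 1%:M 0 + row_mx 0 e = row_mx z e.
    by rewrite mul_mx_row mulmx1 mulmx0 add_row_mx addr0 add0r.
  transitivity (h (lsubmx (row_mx z e)) (rsubmx (row_mx z e))).
    by rewrite row_mxKl row_mxKr.
  by rewrite -rowE.
apply: differentiable_comp; last exact: dh.
apply: differentiableD; last exact: differentiable_cst.
exact: differentiable_mulmxr.
Qed.

(** A vector-valued map has no mean value equality, but its pairing with a fixed column [w] does;
    the point [y] depends on [w]. *)
Lemma mvt_mulmx (R : realType) (n p : nat) (g : 'rV[R]_n -> 'rV[R]_p)
    (x d : 'rV[R]_n) (w : 'cV[R]_p) :
  (forall y, differentiable g y) ->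
  exists y, ((g (x + d) - g x) *m w) 0 0 = (d *m jacobian g y *m w) 0 0.
Proof.
move=> dg.
(* [G t] is the 1-by-1 matrix [g (x + t d) w], restricting the problem to the segment from [x] to
   [x + d]. *)
pose G := (mulmxr w : 'rV_p -> 'rV_1) \o
  (g \o (( *:%R ^~ d : R -> 'rV_n) + cst x)).
pose l := fun t : R => t *: d + x.
have dG t : is_diff t G (mulmxr w \o ('d g (l t) \o (( *:%R ^~ d) + cst 0))).
  refine (is_diff_comp _ (is_diff_mulmxr _ _)).
  exact: (is_diff_comp _ (differentiableP (dg (l t)))).
have DG t : 'D_1 G t = d *m jacobian g (l t) *m w.
  have [dGt eG] := dG t.
  by rewrite deriveE // eG /= !fctE /= scale1r addr0 -deriveE // deriveEjacobian.
have derG t : derivable G t 1 by apply: diff_derivable; case: (dG t).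
have derG0 (t : R) :
    is_derive t 1 (fun t : R => G t 0 0) ((d *m jacobian g (l t) *m w) 0 0).
  rewrite -DG derive_mx // mxE; apply: derivableP.
  by move: (derG t) => /derivable_mxP; apply.
have [//|c _] := @MVT R _ _ 0 1 ltr01 (fun t _ => derG0 t).
  apply: continuous_subspaceT => t.
  exact/differentiable_continuous/derivable1_diffP/ex_derive.
rewrite subr0 mulr1 /G /= !fctE /= scale1r scale0r add0r => E.
by exists (l c); rewrite -E [x + d]addrC mulmxBl !mxE.
Qed.

Lemma enorm_sqr (R : realType) (n : nat) (v : 'rV[R]_n) :
  enorm v ^+ 2 = (v *m v^T) 0 0.
Proof.
rewrite /enorm sqr_sqrtr; last by apply: sumr_ge0 => i _; exact: sqr_ge0.
by rewrite mxE; apply: eq_bigr => i _; rewrite !mxE expr2.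
Qed.

(** A nonzero row [v] of the kernel would give [v P v^T = 0]. *)
Lemma posdefmx_unitmx (R : realType) (n : nat) (P : 'M[R]_n) :
  posdefmx P -> P \in unitmx.
Proof.
move=> [_ Ppos]; rewrite -row_free_unit -kermx_eq0.
apply/eqP/row_matrixP => i; rewrite row0; apply/eqP/negPn/negP => /Ppos.
by rewrite -row_mul mulmx_ker row0 mul0mx mxE ltxx.
Qed.

Lemma posdefmx_semi (R : realType) (n : nat) (P : 'M[R]_n) :
  posdefmx P -> possemidefmx P.
Proof.
move=> [symP Ppos]; split=> // v; have [->|/Ppos/ltW//] := eqVneq v 0.
by rewrite !mul0mx mxE.
Qed.

Definition bform (R : realType) (n : nat) (M : 'M[R]_n) (u v : 'rV[R]_n) : R :=
  (u *m M *m v^T) 0 0.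

Lemma bform_tr (R : realType) (n : nat) (M : 'M[R]_n) (u v : 'rV[R]_n) :
  bform M u v = bform M^T v u.
Proof.
have e (A : 'M[R]_1) : A 0 0 = A^T 0 0 by rewrite mxE.
by rewrite /bform e !trmx_mul trmxK mulmxA.
Qed.

Lemma posdefmx_inv_ge0 (R : realType) (n : nat) (P : 'M[R]_n) (v : 'rV[R]_n) :
  posdefmx P -> 0 <= bform (invmx P) v v.
Proof.
move=> Ppos; have PU := posdefmx_unitmx Ppos.
have [symP Pge0] := posdefmx_semi Ppos.
(* The substitution [w = v P^-1] turns [w P w^T] into [v P^-1 v^T]. *)
have := Pge0 (v *m invmx P).
by rewrite mulmxKV // trmx_mul trmx_inv symP mulmxA.
Qed.

Lemma posdefmx_young (R : realType) (n : nat) (P : 'M[R]_n) (v : 'rV[R]_n) :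
  posdefmx P ->
  2 * (v *m v^T) 0 0 <= bform P v v + bform (invmx P) v v.
Proof.
move=> Ppos; have PU := posdefmx_unitmx Ppos.
have [symP Pge0] := posdefmx_semi Ppos.
(* In the expansion of this square each of the two cross terms is [- v v^T]. *)
have := Pge0 (v - v *m invmx P).
rewrite linearB /= trmx_mul trmx_inv symP !mulmxBl !mulmxBr !mulmxA !(mulmxKV PU).
rewrite (mulmxK PU) /bform !mxE; lra.
Qed.

Lemma possemidefmx_block (R : realType) (n : nat) (A F P : 'M[R]_n)
    (a b : 'rV[R]_n) :
  possemidefmx (block_mx A F^T F P) ->
  0 <= bform A a a + 2 * bform F b a + bform P b b.
Proof.
move=> [_ /(_ (row_mx a b))].
rewrite mul_row_block tr_row_mx mul_row_col !mulmxDl.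
rewrite [X in _ <= X -> _](_ : _ =
    bform A a a + bform F b a + (bform F^T a b + bform P b b)).
  by rewrite -[bform F^T a b]bform_tr; lra.
by rewrite [LHS]mxE; congr (_ + _); rewrite mxE.
Qed.

Lemma lmi_decrease (R : realType) (n : nat) (P J : 'M[R]_n) (kappa : R)
    (d d' : 'rV[R]_n) :
  posdefmx P ->
  possemidefmx (block_mx ((2 - kappa)%:M - P) J J^T P) ->
  bform (invmx P) d' d' = bform (J *m invmx P) d d' ->
  bform (invmx P) d' d' <= bform (invmx P) d d - kappa * (d *m d^T) 0 0.
Proof.
move=> Ppos lmi mvt; have PU := posdefmx_unitmx Ppos; have [symP _] := Ppos.
(* With this second block the cross terms contribute [-2 V d'] and the corner [P] contributes
   [V d'], leaving [- V d'] in total. *)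
have := @possemidefmx_block _ _ ((2 - kappa)%:M - P) J^T P d (- (d' *m invmx P)).
rewrite trmxK => /(_ lmi).
have -> : bform ((2 - kappa)%:M - P) d d =
    (2 - kappa) * (d *m d^T) 0 0 - bform P d d.
  by rewrite /bform mulmxBr mulmxBl mul_mx_scalar -scalemxAl !mxE.
have -> : bform J^T (- (d' *m invmx P)) d = - bform (invmx P) d' d'.
  rewrite mvt [in RHS]bform_tr trmx_mul trmx_inv symP /bform.
  by rewrite !mulNmx mxE !mulmxA.
have -> : bform P (- (d' *m invmx P)) (- (d' *m invmx P)) =
    bform (invmx P) d' d'.
  rewrite /bform linearN /= mulNmx mulmxN mulNmx opprK mulmxKV // trmx_mul.
  by rewrite trmx_inv symP mulmxA.
by have := posdefmx_young d Ppos; lra.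
Qed.

(** Since [V] stays nonnegative, telescoping bounds every partial sum by [V 0 / kappa], uniformly in
    its length. *)
Lemma nneseries_dissipation (R : realType) (V w : nat -> R) (kappa : R) :
  0 < kappa -> (forall t, 0 <= V t) -> (forall t, 0 <= w t) ->
  (forall t, V t.+1 <= V t - kappa * w t) ->
  (\sum_(0 <= t <oo) (w t)%:E < +oo)%E.
Proof.
move=> k0 V0 w0 dec.
have tel N : kappa * (\sum_(0 <= t < N) w t) <= V 0%N - V N.
  elim: N => [|N IH]; first by rewrite big_geq // mulr0 subrr.
  by rewrite big_nat_recr //= mulrDr; have := dec N; lra.
apply: (@le_lt_trans _ _ (V 0%N / kappa)%:E); last by rewrite ltry.
apply: lime_le; first by apply: is_cvg_nneseries => t _ _; rewrite lee_fin.
apply: nearW => N /=; rewrite sumEFin lee_fin ler_pdivlMr // mulrC.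
by apply: le_trans (tel N) _; rewrite lerBlDr lerDl.
Qed.

Theorem theorem3 (R : realType) (n m s q : nat)
    (f : 'I_q.+1 -> 'rV[R]_n -> 'rV[R]_m -> 'rV[R]_s -> 'rV[R]_n)
    (hf : forall (i : 'I_q.+1) (u : 'rV[R]_m),
      cont_diff (fun z : 'rV[R]_(n + s) => f i (lsubmx z) u (rsubmx z)))
    (theta : 'rV[R]_q.+1)
    (hLMI : exists (P : 'M[R]_n) (kappa : R),
      [/\ P^T = P, posdefmx P, 0 < kappa &
        forall (x : 'rV[R]_n) (u : 'rV[R]_m) (e : 'rV[R]_s),
          possemidefmx
            (block_mx ((2 - kappa)%:M - P) (state_jacobian f theta x u e)^T
                      (state_jacobian f theta x u e) P)]) :
  incrementally_l2_contraction_stable (agent_model f theta).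
Proof.
have [P [kappa [_ Ppos k0 lmi]]] := hLMI.
move=> u e x1 x2 tr1 tr2 _.
(* [J] keeps the row-vector convention of [jacobian]; the matrix in the inequality is its
   transpose. *)
pose J y v w : 'M[R]_n :=
  \sum_(i < q.+1) theta 0 i *: jacobian (fun y => f i y v w) y.
have JE y v w : state_jacobian f theta y v w = (J y v w)^T.
  by rewrite linear_sum; apply: eq_bigr => i _; rewrite linearZ.
have df i v w y : differentiable (fun y => f i y v w) y.
  by apply: (@differentiable_partial _ _ _ _ (fun y w => f i y v w)); case: (hf i v).
have gE v w : (fun y => agent_model f theta y v w) =
    \sum_(i < q.+1) (theta 0 i *: (fun y => f i y v w)).
  by apply/funext => z; rewrite fct_sumE.
have dg v w y : differentiable (fun y => agent_model f theta y v w) y.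
  by rewrite gE; apply: differentiable_sum => i; exact: differentiableZ.
have jacg v w y : jacobian (fun y => agent_model f theta y v w) y = J y v w.
  (* Row [j] of a Jacobian is the derivative along the [j]-th basis vector, so linearity of
     directional derivatives suffices. *)
  apply/row_matrixP => j; rewrite !rowE -deriveEjacobian // /J mulmx_sumr.
  rewrite gE derive_sum; last by move=> i; apply/derivableZ/diff_derivable.
  apply: eq_bigr => i _; rewrite deriveZ; last exact: diff_derivable.
  by rewrite deriveEjacobian // -scalemxAr.
apply: (@nneseries_dissipation _
  (fun t => bform (invmx P) (x1 t - x2 t) (x1 t - x2 t)) _ kappa) => // t.
- exact: posdefmx_inv_ge0.
- exact: sqr_ge0.
(* Pairing with [P^-1 d'^T], where [d'] is the next difference, makes the left side [V d']. The
   point [y] varies with [t] and need not lie on either trajectory, which is harmless because the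
   matrix inequality holds at every state. *)
have [y] := @mvt_mulmx _ _ _ (fun y => agent_model f theta y (u t) (e t))
  (x2 t) (x1 t - x2 t) (invmx P *m (x1 t.+1 - x2 t.+1)^T) (dg (u t) (e t)).
rewrite jacg [x2 t + _]addrC subrK -tr1 -tr2 => E.
rewrite enorm_sqr; apply: (lmi_decrease (J := J y (u t) (e t))) => //.
  by have := lmi y (u t) (e t); rewrite JE trmxK.
by rewrite /bform mulmxA -mulmxA E !mulmxA.
Qed.
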